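(* Consider the following dynamic program. Order the items lexicographically by their index pairs: $e_{ab} \preceq e_{ij}$ iff $a<i$, or $a=i$ and $b\le j$. For every item $e_{ij}$ and every integer $k\in\{0,1,\dots,W\}$ define $\beta(i,j,k)\in\mathbb{R}\cup\{-\infty\}$ as follows (where $\beta(\cdot,\cdot,k)=-\infty$ whenever $k<0$ or $k>W$). For the first item $e_{ij}$ in the order $\preceq$: $\beta(i,j,0)=B(\emptyset)$, $\beta(i,j,w_{ij})=B(\{e_{ij}\})$, and $\beta(i,j,k)=-\infty$ for all other $k$. For every other item $e_{ij}$ with immediate predecessor $e_{i'j'}$ in $\preceq$: $$\beta(i,j,k)=\max\Big\{\beta(i',j',k),\ \ \beta(i',j',k-w_{ij})+p_{ij}-R\,d_{in}\Big(\frac{1}{v_{\max}-\nu k}-\frac{1}{v_{\max}-\nu(k-w_{ij})}\Big)\Big\},$$ where $d_{in}=\sum_{l=i}^{n} d_l$ and $-\infty$ plus a real number is $-\infty$. Then for every item $e_{ij}$ and every $k\in\{0,\dots,W\}$, $\beta(i,j,k)$ equals the maximum of $B(S)$ over all subsets $S\subseteq I_{ij}=\{e_{ab}\mid e_{ab}\preceq e_{ij}\}$ whose total weight is exactly $k$ (and equals $-\infty$ if no such subset exists).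
   Context: Packing While Traveling (PWT): there are $n+1$ cities on a fixed route $1,2,\dots,n+1$, with positive distances $d_i$ from city $i$ to city $i+1$ ($1\le i\le n$). City $i$ ($1\le i\le n$) holds a finite set $M_i$ of items $e_{i1},\dots,e_{im_i}$; item $e_{ij}$ has positive integer profit $p_{ij}$ and positive integer weight $w_{ij}$. A vehicle travels the route with maximal speed $v_{\max}$ and minimal speed $v_{\min}$, $0<v_{\min}<v_{\max}$, and has capacity $W$ (a positive integer); set $\nu=(v_{\max}-v_{\min})/W$. A renting rate $R>0$ is given. A subset $S$ of items is encoded by $x_{ij}\in\{0,1\}$ ($x_{ij}=1$ iff $e_{ij}\in S$). Its benefit is $B(S)=P(S)-R\,T(S)$ with $P(S)=\sum_{i,j}p_{ij}x_{ij}$ and $T(S)=\sum_{i=1}^n \frac{d_i}{v_{\max}-\nu\sum_{k=1}^{i}\sum_{j=1}^{m_k}w_{kj}x_{kj}}$. $B(\emptyset)=-R\sum_{i=1}^n d_i/v_{\max}$ and $B(\{e_{ij}\})$ is the benefit when only item $e_{ij}$ is selected. *)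

(* Defs.v *)
From HB Require Import structures.
From mathcomp Require Import all_boot all_order all_algebra.
From mathcomp Require Import reals constructive_ereal.

Set Implicit Arguments.
Unset Strict Implicit.
Unset Printing Implicit Defensive.

Import Order.TTheory GRing.Theory Num.Theory.
Local Open Scope ring_scope.

(* Indices are 0-based: [i : 'I_ncity] is the (i+1)-st city of the route (the
   final city, which holds no items, has no index), and [dist i] is the
   distance from it to the next city. *)
Record pwt (R : realType) := Pwt {
  ncity : nat;
  nitem : 'I_ncity -> nat;
  dist : 'I_ncity -> R;
  profit : forall i, 'I_(nitem i) -> nat;
  weight : forall i, 'I_(nitem i) -> nat;
  vmax : R;
  vmin : R;
  capacity : nat;
  rent : R;
  dist_gt0 : forall i, 0 < dist i;
  profit_gt0 : forall i (j : 'I_(nitem i)), (0 < profit j)%N;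
  weight_gt0 : forall i (j : 'I_(nitem i)), (0 < weight j)%N;
  vmin_gt0 : 0 < vmin;
  vmin_lt_vmax : vmin < vmax;
  capacity_gt0 : (0 < capacity)%N;
  rent_gt0 : 0 < rent
}.

Arguments dist {R} p i.
Arguments profit {R} p i j.
Arguments weight {R} p i j.

Section Definitions.
Variables (R : realType) (I : pwt R).

(* The item e_ij is the dependent pair of i and j. *)
Definition item : finType := {i : 'I_(ncity I) & 'I_(nitem i)}.

Definition mkitem (i : 'I_(ncity I)) (j : 'I_(nitem i)) : item :=
  Tagged (fun i => 'I_(nitem i)) j.

Definition item_profit (e : item) : nat := profit I (tag e) (tagged e).
Definition item_weight (e : item) : nat := weight I (tag e) (tagged e).

Definition selected (S : {set item}) i (j : 'I_(nitem i)) : nat :=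
  mkitem j \in S.

Definition nu : R := (vmax I - vmin I) / (capacity I)%:R.

Definition total_profit (S : {set item}) : nat :=
  (\sum_(i < ncity I) \sum_(j < nitem i) profit I i j * selected S j)%N.

Definition total_weight (S : {set item}) : nat :=
  (\sum_(i < ncity I) \sum_(j < nitem i) weight I i j * selected S j)%N.

Definition load (S : {set item}) (i : 'I_(ncity I)) : nat :=
  (\sum_(k < ncity I | k <= i)
     \sum_(j < nitem k) weight I k j * selected S j)%N.

Definition travel_time (S : {set item}) : R :=
  \sum_(i < ncity I) dist I i / (vmax I - nu * (load S i)%:R).

Definition benefit (S : {set item}) : R :=
  (total_profit S)%:R - rent I * travel_time S.

Definition item_le (e f : item) : bool :=
  ((tag e < tag f) || ((tag e == tag f) && (tagged e <= tagged f)))%N.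

Definition item_lt (e f : item) : bool := (e != f) && item_le e f.

Definition first_item (e : item) : bool := [forall f, item_le e f].

Definition immediate_pred (e' e : item) : bool :=
  item_lt e' e && ~~ [exists f, item_lt e' f && item_lt f e].

Definition dist_to_end (i : 'I_(ncity I)) : R :=
  \sum_(l < ncity I | (i <= l)%N) dist I l.

Definition speed_at (k : int) : R := vmax I - nu * k%:~R.

(* The defining equations of the dynamic program; the third argument ranges
   over all integers so that k - w_ij is a genuine subtraction. *)
Definition dp_table (beta : item -> int -> \bar R) : Prop :=
  [/\ forall e (k : int), (k < 0) || ((capacity I)%:Z < k) -> beta e k = -oo%E,
      forall e (k : int), first_item e -> 0 <= k <= (capacity I)%:Z ->
        beta e k = if k == 0 then (benefit set0)%:E
                   else if k == (item_weight e)%:Z then (benefit [set e])%:E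
                   else -oo%E
    & forall e' e (k : int), immediate_pred e' e -> 0 <= k <= (capacity I)%:Z ->
        let w := (item_weight e)%:Z in
        beta e k =
          maxe (beta e' k)
               (beta e' (k - w)%R
                + ((item_profit e)%:R
                   - rent I * dist_to_end (tag e)
                     * (1 / speed_at k - 1 / speed_at (k - w)))%:E)%E].

(* The equations are satisfiable; [dp_fuel N e] is the intended table as soon
   as N exceeds the number of items preceding e. *)
Fixpoint dp_fuel (N : nat) (e : item) (k : int) : \bar R :=
  if N is N'.+1 then
    if (k < 0) || ((capacity I)%:Z < k) then -oo%E
    else if first_item e then
      if k == 0 then (benefit set0)%:E
      else if k == (item_weight e)%:Z then (benefit [set e])%:E
      else -oo%E
    else if [pick e' | immediate_pred e' e] is Some e' then
      let w := (item_weight e)%:Z in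
      maxe (dp_fuel N' e' k)
           (dp_fuel N' e' (k - w)%R
            + ((item_profit e)%:R
               - rent I * dist_to_end (tag e)
                 * (1 / speed_at k - 1 / speed_at (k - w)))%:E)%E
    else -oo%E
  else -oo%E.

Let rank (e : item) : nat := #|[set f | item_lt f e]|.

Lemma item_le_total e f : item_le e f || item_le f e.
Proof.
rewrite /item_le; case: ltngtP => //= ef; rewrite ?orbT //.
by rewrite -!val_eqE /= ef eqxx leq_total.
Qed.

Lemma item_le_anti e f : item_le e f -> item_le f e -> e = f.
Proof.
case: e f => [i j] [i' j']; rewrite /item_le /= -!val_eqE /=.
case: ltngtP => //= /val_inj ii'; case: _ / ii' j' => j' l1 l2.
by congr Tagged; apply/val_inj/eqP; rewrite eqn_leq l1.
Qed.

Lemma item_le_trans f e g : item_le e f -> item_le f g -> item_le e g.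
Proof.
rewrite /item_le -!val_eqE /=.
case: (ltngtP (tag e) (tag f)) => //= [ef|ef].
  by case: (ltngtP (tag f) (tag g)) => //= [fg|fg] _ _;
     rewrite ?(ltn_trans ef fg) // -fg ef.
rewrite ef; case: (ltngtP (tag f) (tag g)) => //= _; exact: leq_trans.
Qed.

Lemma item_lt_le_trans f e g : item_lt e f -> item_le f g -> item_lt e g.
Proof.
move=> /andP[nef ef] fg; rewrite /item_lt (item_le_trans ef fg) andbT.
by apply: contra nef => /eqP eg; rewrite -eg in fg; rewrite (item_le_anti ef fg).
Qed.

Lemma immediate_pred_inj e1 e2 e :
  immediate_pred e1 e -> immediate_pred e2 e -> e1 = e2.
Proof.
move=> /andP[l1 /existsPn n1] /andP[l2 /existsPn n2].
apply/eqP; apply: contraT => ne; case/orP: (item_le_total e1 e2) => le12.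
  by have := n1 e2; rewrite /item_lt ne le12 /=; move: l2; rewrite /item_lt => ->.
by have := n2 e1; rewrite /item_lt eq_sym ne le12 /=;
   move: l1; rewrite /item_lt => ->.
Qed.

Lemma immediate_pred_first e' e : immediate_pred e' e -> first_item e = false.
Proof.
move=> /andP[/andP[ne le] _]; apply/negP => /forallP/(_ e') le'.
by rewrite (item_le_anti le le') eqxx in ne.
Qed.

Lemma rank_immediate_pred e' e : immediate_pred e' e -> (rank e' < rank e)%N.
Proof.
move=> /andP[lt _]; apply/proper_card/properP; split.
  apply/subsetP => f; rewrite !inE => fe'.
  by apply: item_lt_le_trans fe' _; case/andP: lt.
by exists e'; rewrite !inE // /item_lt eqxx.
Qed.

Lemma dp_fuel_indep N N' e k :
  (rank e < N)%N -> (rank e < N')%N -> dp_fuel N e k = dp_fuel N' e k.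
Proof.
elim: N N' e k => [//|N IH] [//|N'] e k rN rN' /=.
case: ifP => // _; case: ifP => // _; case: pickP => // e' ip.
have r := rank_immediate_pred ip.
by rewrite !(IH N' e') // (leq_trans r).
Qed.

Lemma dp_table_exists : exists beta, dp_table beta.
Proof.
pose beta e k := dp_fuel (rank e).+1 e k.
exists beta; split=> [e k kN|e k fe|e' e k ip] /=.
- by rewrite /beta /= kN.
- by move=> /andP[k0 kW]; rewrite /beta /= !ltNge k0 kW fe.
move=> /andP[k0 kW]; rewrite {1}/beta /= !ltNge k0 kW /=.
rewrite (immediate_pred_first ip); case: pickP => [e2 ip2|/(_ e')]; last first.
  by rewrite ip.
rewrite (immediate_pred_inj ip2 ip) /beta.
have r := rank_immediate_pred ip.
by rewrite !(@dp_fuel_indep (rank e) (rank e').+1 e').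
Qed.

End Definitions.

(* Main.v *)
Require Import Defs.
From HB Require Import structures.
From mathcomp Require Import all_boot all_order all_algebra.
From mathcomp Require Import reals constructive_ereal.
From mathcomp Require Import ring.

Import Order.TTheory GRing.Theory Num.Theory.
Local Open Scope ring_scope.

(** Adding an item [e] to a set [S] of items preceding it changes the load only
    on the roads from the city of [e] onwards, and there the load of [S] is
    already its total weight. So the change of benefit depends on [S] through
    its weight alone, and splitting the feasible sets according to whether they
    contain [e] yields the recurrence. *)

Section Benefit.
Context {R : realType} {I : pwt R}.
Implicit Types (e f : item I) (S D : {set item I}).

(** Flattening the double sum over cities and indices lets profit, weight and load be handled as
    sums over the members of [S]; the filter [P] on cities is what the load needs. *)
Lemma sum_selected (P : pred 'I_(ncity I)) (F : forall i, 'I_(nitem i) -> nat) S :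
  (\sum_(i < ncity I | P i) \sum_(j < nitem i) F i j * selected S j =
   \sum_(f in S | P (tag f)) F (tag f) (tagged f))%N.
Proof.
rewrite (@sig_big_dep _ _ _ _ _ P (fun=> predT)
  (fun i j => F i j * selected S j)%N) /= big_mkcond [RHS]big_mkcond /=.
apply: eq_bigr => -[i j] _ /=; rewrite andbT /selected /mkitem.
by case: (P i); case: (_ \in S); rewrite ?muln1 ?muln0 ?andbF.
Qed.

Lemma total_profitE S : total_profit S = (\sum_(f in S) item_profit f)%N.
Proof.
rewrite /total_profit (sum_selected predT); apply: eq_bigl => f.
by rewrite andbT.
Qed.

Lemma total_weightE S : total_weight S = (\sum_(f in S) item_weight f)%N.
Proof.
rewrite /total_weight (sum_selected predT); apply: eq_bigl => f.
by rewrite andbT.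
Qed.

Lemma loadE S i : load S i = (\sum_(f in S | (tag f <= i)%N) item_weight f)%N.
Proof. by rewrite /load (sum_selected (fun k => (k <= i)%N)). Qed.

Lemma total_profitU1 S e : e \notin S ->
  total_profit (e |: S) = (item_profit e + total_profit S)%N.
Proof. by move=> eS; rewrite !total_profitE big_setU1. Qed.

Lemma total_weightU1 S e : e \notin S ->
  total_weight (e |: S) = (item_weight e + total_weight S)%N.
Proof. by move=> eS; rewrite !total_weightE big_setU1. Qed.

Lemma loadU1_before S e (i : 'I_(ncity I)) : (i < tag e)%N -> load (e |: S) i = load S i.
Proof.
move=> ie; rewrite !loadE; apply: eq_bigl => f; rewrite !inE.
by case: eqP => // ->; rewrite leqNgt ie !andbF.
Qed.

Lemma load_total S (i : 'I_(ncity I)) :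
  (forall f, f \in S -> (tag f <= i)%N) -> load S i = total_weight S.
Proof.
move=> le; rewrite loadE total_weightE; apply: eq_bigl => f.
by case: (boolP (f \in S)) => // /le ->.
Qed.

Lemma item_lexx e : item_le e e.
Proof. by have := item_le_total e e; rewrite orbb. Qed.

Lemma item_le_tag e f : item_le e f -> (tag e <= tag f)%N.
Proof. by case/orP => [/ltnW//|/andP[/eqP ef _]]; rewrite ef. Qed.

(** The increment in the recurrence for [beta]; [k] is the weight after [e] has been added. *)
Definition marginal e (k : int) : R :=
  (item_profit e)%:R - rent I * dist_to_end (tag e)
    * (1 / speed_at I k - 1 / speed_at I (k - (item_weight e)%:Z)).

Lemma benefitU1 S e : (forall f, f \in S -> item_lt f e) ->
  benefit (e |: S) = benefit S + marginal e (total_weight (e |: S))%:Z.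
Proof.
move=> Slt; have eS : e \notin S by apply/negP => /Slt; rewrite /item_lt eqxx.
have Stag f : f \in S -> (tag f <= tag e)%N.
  by move=> /Slt /andP[_ /item_le_tag].
rewrite /benefit /marginal total_profitU1 // natrD.
suff -> : travel_time (e |: S) = travel_time S + dist_to_end (tag e) *
    (1 / speed_at I (total_weight (e |: S))%:Z
     - 1 / speed_at I ((total_weight (e |: S))%:Z - (item_weight e)%:Z)).
  by ring.
have -> : (total_weight (e |: S))%:Z - (item_weight e)%:Z = (total_weight S)%:Z.
  by rewrite total_weightU1 // PoszD addrAC subrr add0r.
(* Padding the tail sum with zeros before the city of [e] reduces the claim to a comparison road by
   road. *)
rewrite /travel_time /dist_to_end mulr_suml [X in _ = _ + X]big_mkcond -big_split /=.
apply: eq_bigr => i _; case: leqP => [ei|ie]; last first.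
  by rewrite loadU1_before // addr0.
rewrite !load_total; first by rewrite /speed_at !pmulrn; ring.
  by move=> f /Stag fe; apply: leq_trans ei.
by move=> f /setU1P[->//|/Stag fe]; apply: leq_trans ei.
Qed.

(** Allowing any set [D], not only an initial segment, lets the recursion start from the empty
    set. *)
Definition opt D (k : nat) : \bar R :=
  \big[maxe/-oo%E]_(S : {set item I} | (S \subset D) && (total_weight S == k))
    (benefit S)%:E.

Lemma opt_set0 k :
  opt set0 k = if k == 0%N then (benefit (set0 : {set item I}))%:E else -oo%E.
Proof.
have w0 : total_weight (set0 : {set item I}) = 0%N.
  by rewrite total_weightE big_set0.
rewrite /opt; case: eqP => [->|k0].
  rewrite (big_pred1 set0) // => S; rewrite subset0 /=.
  by case: eqP => // ->; rewrite w0 eqxx.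
apply: big1 => S; rewrite subset0 => /andP[/eqP -> ].
by rewrite w0 eq_sym => /eqP.
Qed.

(** Subtraction on [nat] truncates, so the test on the weight of [e] stands in for the value [-oo]
    of the table at negative arguments. *)
Lemma optU1 D e k : (forall f, f \in D -> item_lt f e) ->
  opt (e |: D) k =
    maxe (opt D k)
      (if (item_weight e <= k)%N
       then (opt D (k - item_weight e) + (marginal e k%:Z)%:E)%E else -oo%E).
Proof.
move=> Dlt; have eD : e \notin D by apply/negP => /Dlt; rewrite /item_lt eqxx.
rewrite {1}/opt (bigID (fun S : {set item I} => e \in S)) /= maxC; congr maxe.
  apply: eq_bigl => S; rewrite andbAC; congr andb.
  apply/andP/idP => [[SD eS]|SD]; last first.
    by rewrite (subset_trans SD) ?subsetUr // (contra (subsetP SD e)).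
  by rewrite -(setU1K eD) subsetD1 SD.
have sub S : S \subset D -> e \notin S by move=> SD; apply: contra (subsetP SD e) _.
case: leqP => [wk|kw]; last first.
  apply: big1 => S /andP[/andP[_ /eqP wS] eS].
  by move: kw; rewrite -wS total_weightE (big_setD1 e) //= ltnNge leq_addr.
(* The sets containing [e] are written [e |: S]; the round-trip condition of this reindexing amounts
   to [e \notin S]. *)
rewrite (reindex_onto (fun S => e |: S) (fun S => S :\ e)) /=; last first.
  by move=> S /andP[_ eS]; rewrite setD1K.
(* Adding a real constant commutes with [maxe] and fixes [-oo], so it leaves the maximum even when
   no set is feasible. *)
have addM : {morph (fun x : \bar R => x + (marginal e k%:Z)%:E)%E :
    x y / maxe x y} by move=> x y; rewrite adde_maxl.
rewrite /opt (big_morph _ addM (id1 := -oo%E)) //.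
apply: eq_big => [S|S].
  rewrite setU11 andbT; apply/idP/idP.
    move=> /andP[/andP[SD wS] /eqP eS].
    have neS : e \notin S by rewrite -eS setD11.
    move: wS; rewrite total_weightU1 // => /eqP <-; rewrite addKn eqxx andbT.
    by rewrite -(setU1K neS) -(setU1K eD) setSD.
  move=> /andP[SD /eqP wS]; have eS := sub _ SD.
  by rewrite setUS // total_weightU1 // wS subnKC // setU1K ?eqxx.
move=> /andP[/andP[/andP[SD /eqP wS] _] /eqP eS].
have neS : e \notin S by rewrite -eS setD11.
rewrite benefitU1 ?wS // => f fS; apply: Dlt.
have /setU1P[fe|//] := subsetP SD f (setU1r _ fS).
by rewrite -fe fS in neS.
Qed.

Lemma first_item_le e : first_item e -> [set f | item_le f e] = [set e].
Proof.
move=> /forallP fe; apply/setP => f; rewrite !inE; apply/idP/eqP => [le|->].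
  exact: item_le_anti le (fe f).
exact: item_lexx.
Qed.

(** By totality, an item below [e] that is neither [e] nor strictly between [e'] and [e] is at or
    below [e']. *)
Lemma immediate_pred_le e' e : immediate_pred e' e ->
  [set f | item_le f e] = e |: [set f | item_le f e'].
Proof.
move=> /andP[/andP[ne le] /existsPn nb]; apply/setP => f; rewrite !inE.
apply/idP/orP => [fe|[/eqP ->|fe']].
- have [|nfe] := eqVneq f e; [by left | right].
  have := nb f; rewrite {2}/item_lt nfe fe !andbT /item_lt.
  have [<- _|_ /= nle] := eqVneq e' f; first exact: item_lexx.
  by have := item_le_total e' f; rewrite (negbTE nle).
- exact: item_lexx.
- exact: item_le_trans fe' le.
Qed.

Definition rank e := #|[set f | item_lt f e]|.

Lemma rank_lt e f : item_lt e f -> (rank e < rank f)%N.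
Proof.
move=> lt; apply/proper_card/properP; split.
  apply/subsetP => g; rewrite !inE => ge.
  by apply: item_lt_le_trans ge _; case/andP: lt.
by exists e; rewrite !inE // /item_lt eqxx.
Qed.

Lemma immediate_pred_exists e :
  ~~ first_item e -> exists e', immediate_pred e' e.
Proof.
move=> /forallPn[f0 nle].
have lt0 : item_lt f0 e.
  have le : item_le f0 e by have := item_le_total e f0; rewrite (negbTE nle).
  by rewrite /item_lt le andbT; apply: contraNneq nle => ->; exact: item_lexx.
(* A predecessor of maximal rank is immediate, since an item strictly between would have a larger
   rank. *)
case: (@arg_maxnP _ f0 (fun f => item_lt f e) rank lt0) => e' lt' e'_max.
exists e'.
rewrite /immediate_pred lt'; apply/existsPn => f; apply/negP => /andP[lt1 lt2].
by have := e'_max f lt2; rewrite /= leqNgt rank_lt.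
Qed.

End Benefit.

Theorem theorem1 (R : realType) (I : pwt R) (beta : item I -> int -> \bar R)
    (beta_dp : dp_table beta) (e : item I) (k : nat)
    (k_le : (k <= capacity I)%N) :
  beta e k%:Z =
    \big[maxe/-oo%E]_(S : {set item I} |
        (S \subset [set f | item_le f e]) && (total_weight S == k))
      (benefit S)%:E.
Proof.
rewrite -/(opt _ _); case: beta_dp => out init step.
have [m] := ubnP (rank e); elim: m e k k_le => // m IH e k k_le rk.
have k_in : 0 <= k%:Z <= (capacity I)%:Z by rewrite !lez_nat k_le.
case: (boolP (first_item e)) => [fe|/immediate_pred_exists [e' ip]].
  (* The base case is the same recurrence, applied to [D = set0]. *)
  rewrite init // first_item_le // -(setU0 [set e]) optU1; last by move=> f; rewrite inE.
  rewrite !opt_set0 !eqz_nat; case: (ltngtP k (item_weight e)) => [kw|wk|kw].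
  - by rewrite maxeNy.
  - rewrite subn_eq0 leqNgt wk /= addNye maxeNy.
    by case: eqP wk => // ->; rewrite ltn0.
  (* Positivity of the weight keeps the prescribed values at [0] and at the weight of [e] from
     colliding. *)
  have w_gt0 : (0 < item_weight e)%N by exact: weight_gt0.
  rewrite kw subnn eqn0Ngt w_gt0 /= maxNye -EFinD; congr EFin.
  rewrite benefitU1 => [|f]; last by rewrite inE.
  by rewrite total_weightU1 ?inE // total_weightE big_set0 addn0.
have /andP[/andP[_ le'] _] := ip; have lt' : item_lt e' e by case/andP: ip.
have D_lt f : f \in [set f | item_le f e'] -> item_lt f e.
  rewrite inE => fe'; rewrite /item_lt (item_le_trans fe' le') andbT.
  apply: contraTneq lt' => fe; rewrite fe in fe'.
  by rewrite /item_lt (item_le_anti le' fe') eqxx.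
have r' : (rank e' < m)%N by apply: leq_trans (rank_lt _ _ lt') _.
rewrite (step _ _ _ ip k_in) (immediate_pred_le _ _ ip) optU1 // IH //; congr maxe.
(* If [e] fits, the integer and natural differences agree and induction applies; otherwise the table
   is read at a negative argument, where it is [-oo]. *)
rewrite -/(marginal _ _); case: leqP => [wk|kw].
  by rewrite subzn // IH // (leq_trans (leq_subr _ _)).
by rewrite out ?addNye // subr_lt0 ltz_nat kw.
Qed.
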